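(* Let $k\ge 2$ and $L\ge 2$. Let $h\in\mathbb{F}_k$ be a cyclically reduced word containing all reduced words of length $L$ as subwords. If $\mathbb{F}_k$ splits relative to $h$ over a subgroup isomorphic to $\mathbb{F}_r$, then $r>(k-1)(L-2)$.
   Context: $\mathbb{F}_k$ is the free group of rank $k$, with elements viewed as reduced words on $X^{\pm1}$, where $X$ is a fixed free basis. A word $a_1\cdots a_q$ with $a_i\in X^{\pm1}$ is reduced if $a_{i+1}\neq a_i^{-1}$ for $1\le i\le q-1$, and cyclically reduced if in addition $a_q\ne a_1^{-1}$; its subwords are the words $a_i\cdots a_j$ with $1\le i\le j\le q$. A splitting of a group $G$ is an isomorphism of $G$ with the fundamental group of a graph of groups, equivalently an action of $G$ on a simplicial tree $T$ that is minimal (no proper invariant subtree), without inversion, and without redundant vertices (a vertex of valence 2 is the unique fixed point of some element of $G$); splittings are assumed non-trivial ($T$ is not a point). A splitting is over a subgroup $A$ if $A$ is an edge group, and relative to $h$ if $h$ fixes a point in $T$ (i.e. is contained in a conjugate of a vertex group). *)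

(* Defs.v *)
From HB Require Import structures.
From Stdlib Require List.
From mathcomp Require Import all_boot.

Set Implicit Arguments.
Unset Strict Implicit.
Unset Printing Implicit Defensive.

(* The letter (i, true) is the basis element x_i and (i, false) its inverse. *)
Definition letter (k : nat) : Type := ('I_k * bool)%type.

Definition letter_inv (k : nat) (a : letter k) : letter k := (a.1, ~~ a.2).

Definition no_cancel (k : nat) : rel (letter k) :=
  fun a b => b != letter_inv a.

Definition reduced (k : nat) (w : seq (letter k)) : bool :=
  sorted (@no_cancel k) w.

(* [cycle] also compares the last letter with the first one. *)
Definition cyclically_reduced (k : nat) (w : seq (letter k)) : bool :=
  cycle (@no_cancel k) w.

Definition cancel_cons (k : nat) (a : letter k) (w : seq (letter k)) :
    seq (letter k) :=
  if w is b :: w' then if b == letter_inv a then w' else a :: w else [:: a].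

Definition reduce (k : nat) (w : seq (letter k)) : seq (letter k) :=
  foldr (@cancel_cons k) [::] w.

Record free_group (k : nat) : Type :=
  FreeGroup { word : seq (letter k); word_reduced : reduced word }.

HB.instance Definition _ (k : nat) := [isSub for @word k].
HB.instance Definition _ (k : nat) := [Choice of free_group k by <:].

Section FreeGroupStructure.

Variable k : nat.
Implicit Types (a b : letter k) (u v w : seq (letter k)) (x y z : free_group k).

Lemma letter_invK : involutive (@letter_inv k).
Proof. by case=> i b; rewrite /letter_inv /= negbK. Qed.

Lemma cancel_cons_reduced a w : reduced w -> reduced (cancel_cons a w).
Proof.
case: w => [|b w] //= Hbw; case: eqP => [_|/eqP Hba]; first exact: path_sorted Hbw.
by rewrite /reduced /= {1}/no_cancel Hba.
Qed.

Lemma foldr_cancel_cons_reduced u v :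
  reduced v -> reduced (foldr (@cancel_cons k) v u).
Proof. by move=> Hv; elim: u => [|a u IH] //=; apply: cancel_cons_reduced. Qed.

Lemma reduce_reduced w : reduced (reduce w).
Proof. exact: foldr_cancel_cons_reduced. Qed.

Lemma reduce_id w : reduced w -> reduce w = w.
Proof.
elim: w => [|a w IH] //= Haw; rewrite (IH (path_sorted Haw)).
by case: w Haw {IH} => [|b w] //= /andP[Hab _]; rewrite (negbTE Hab).
Qed.

Lemma cancel_consK a w :
  reduced w -> cancel_cons a (cancel_cons (letter_inv a) w) = w.
Proof.
case: w => [|b w] /=; first by rewrite eqxx.
rewrite letter_invK; case: eqP => [->|_] /=; last by rewrite eqxx.
by case: w => [|c w] //= /andP[/negbTE ->].
Qed.

Lemma foldr_cancel_cons a u v : reduced v ->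
  foldr (@cancel_cons k) v (cancel_cons a u) =
  cancel_cons a (foldr (@cancel_cons k) v u).
Proof.
move=> Hv; case: u => [|b u] //=; case: eqP => [->|_] //.
by rewrite cancel_consK //; apply: foldr_cancel_cons_reduced.
Qed.

Lemma reduce_cat u v : reduce (u ++ v) = foldr (@cancel_cons k) (reduce v) u.
Proof. exact: foldr_cat. Qed.

Lemma reduce_catl u v : reduce (reduce u ++ v) = reduce (u ++ v).
Proof.
rewrite !reduce_cat; elim: u => [|a u IH] //=.
by rewrite foldr_cancel_cons ?IH // reduce_reduced.
Qed.

Lemma reduce_catr u v : reduce (u ++ reduce v) = reduce (u ++ v).
Proof. by rewrite !reduce_cat (reduce_id (reduce_reduced v)). Qed.

Definition inv_word w : seq (letter k) := rev (map (@letter_inv k) w).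

Lemma inv_wordK : involutive inv_word.
Proof.
move=> w; rewrite /inv_word map_rev revK -map_comp -[RHS]map_id.
by apply: eq_map => a /=; rewrite letter_invK.
Qed.

Lemma inv_word_reduced w : reduced w -> reduced (inv_word w).
Proof.
rewrite /reduced /inv_word rev_sorted sorted_map => Hw.
apply: sub_sorted Hw => a b; rewrite /no_cancel /= letter_invK.
by rewrite eq_sym.
Qed.

Lemma reduce_inv_word w : reduce (w ++ inv_word w) = [::].
Proof.
elim: w => [|a w IH] //.
rewrite /inv_word map_cons rev_cons -cats1 cat_cons catA /=.
rewrite -reduce_catl.
by rewrite [reduce (w ++ _)]IH /= eqxx.
Qed.

Definition free_one : free_group k := FreeGroup (isT : reduced [::]).

Definition free_mul x y : free_group k :=
  FreeGroup (reduce_reduced (word x ++ word y)).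

Definition free_inv x : free_group k :=
  FreeGroup (inv_word_reduced (word_reduced x)).

Lemma free_mulA : associative free_mul.
Proof.
by move=> x y z; apply: val_inj; rewrite /= reduce_catr reduce_catl catA.
Qed.

Lemma free_mul1 : left_id free_one free_mul.
Proof. by move=> x; apply: val_inj; rewrite /= reduce_id // word_reduced. Qed.

Lemma free_mulr1 : right_id free_one free_mul.
Proof.
by move=> x; apply: val_inj; rewrite /= cats0 reduce_id // word_reduced.
Qed.

Lemma free_mulrV : right_inverse free_one free_inv free_mul.
Proof. by move=> x; apply: val_inj; rewrite /= reduce_inv_word. Qed.

Lemma free_mulV : left_inverse free_one free_inv free_mul.
Proof.
move=> x; apply: val_inj => /=.
by rewrite -{2}[word x]inv_wordK reduce_inv_word.
Qed.

HB.instance Definition _ := isGroup.Build (free_group k)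
  free_mulA free_mul1 free_mulr1 free_mulV free_mulrV.

End FreeGroupStructure.

(* A Prop-valued counterpart of [path], as vertices form an arbitrary type. *)
Fixpoint walk (V : Type) (e : V -> V -> Prop) (x : V) (p : seq V) : Prop :=
  if p is y :: p' then e x y /\ walk e y p' else True.

Definition connected_graph (V : Type) (e : V -> V -> Prop) (S : V -> Prop) :
    Prop :=
  forall x y, S x -> S y ->
  exists p, walk (fun u v => e u v /\ S u /\ S v) x p /\ last x p = y.

(* There is no circuit x :: p with at least three distinct vertices. *)
Definition acyclic_graph (V : Type) (e : V -> V -> Prop) : Prop :=
  forall x p, List.NoDup (x :: p) -> walk e x p -> e (last x p) x ->
  size p <= 1.

(* A simplicial tree is encoded by its vertices and their adjacency relation. *)
Record tree : Type := Tree {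
  vertex :> Type;
  adj : vertex -> vertex -> Prop;
  adj_irrefl : forall x, ~ adj x x;
  adj_sym : forall x y, adj x y -> adj y x;
  tree_connected : connected_graph adj (fun _ => True);
  tree_acyclic : acyclic_graph adj
}.

(* A connected subgraph of a tree is the full subgraph on its vertices, so a
   subtree is given by a set of vertices. *)
Definition subtree (T : tree) (S : T -> Prop) : Prop :=
  (exists x, S x) /\ connected_graph (@adj T) S.

Definition valence2 (T : tree) (v : T) : Prop :=
  exists a b : T, a <> b /\ forall w, adj v w <-> w = a \/ w = b.

(* As the action has no inversion, an element fixing an interior point of an
   edge fixes both its endpoints; having a fixed point, or a vertex as unique
   fixed point, can hence be tested on vertices. *)
Record splitting (G : groupType) : Type := Splitting {
  splitting_tree :> tree;
  act : G -> splitting_tree -> splitting_tree;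
  act1 : forall x, act 1%g x = x;
  actM : forall g h x, act (g * h)%g x = act g (act h x);
  act_adj : forall g x y, adj x y -> adj (act g x) (act g y);
  act_minimal : forall S : splitting_tree -> Prop,
    subtree S -> (forall g x, S x -> S (act g x)) -> forall x, S x;
  act_no_inversion : forall g x y,
    adj x y -> ~ (act g x = y /\ act g y = x);
  act_no_redundant : forall v, valence2 v ->
    exists g, act g v = v /\ forall w, act g w = w -> w = v;
  splitting_nontrivial : exists x y : splitting_tree, x <> y
}.

Definition splitting_over (G : groupType) (T : splitting G) (A : G -> Prop) :
    Prop :=
  exists u v : T, adj u v /\
  forall g, A g <-> act g u = u /\ act g v = v.

Definition splitting_relative_to (G : groupType) (T : splitting G) (h : G) :
    Prop :=
  exists v : T, act h v = v.

Definition isomorphic_to_subgroup (H G : groupType) (A : G -> Prop) : Prop :=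
  exists f : {multiplicative H -> G},
    injective f /\ forall g, A g <-> exists x, f x = g.

(* Main.v *)
Require Import Defs.
From mathcomp Require Import all_boot boolp.

(** The idea is to look at the covering graph X of the rose whose fundamental
    group is the edge group [A]: its vertices are the cosets [A g], and an edge
    labelled by the letter [a] runs from [A g] to [A g a].

    Let e = uv be an edge of the tree T with stabilizer [A]. Colour the vertex
    [A g] according to the side of e on which the point g.u lies. This colouring
    ([elliptic_coloring], obtained in [edge_colorP]) has three features. Only
    finitely many edges of X join vertices of different colours, because a path
    of T crosses e finitely often. Both colours occur infinitely often, because
    minimality forbids leaves, so that both half-trees are unbounded and contain
    points of every orbit arbitrarily far from e. And since h is elliptic, a
    lift to X of the bi-infinite line ...hhh... that never closes up has the
    same colour at both of its ends.

    Call an oriented edge of X an exit if no reduced loop starts with it; beyond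
    an exit X is an infinite tree. Every reduced word of length L occurs in h,
    so a common line of h passes through any two exits that are joined by a
    reduced path with at most L - 2 edges ([exit_connect]). Taking the empty
    path shows, by induction from far away, that all ends beyond one exit have
    one colour ([exit_ends_color]). As
    [A] is finitely generated, X is a finite graph with trees attached, whence
    both colours are the colour of some exit ([exit_of_color]). A shortest path
    between exits of different colours has length at least L - 1
    ([bichrome_long]), its interior vertices are distinct ([inner_inj]), and by
    minimality no exit starts at any of them ([inner_loops]).

    The loops that start at these L - 2 or more interior vertices form a finite
    subgraph Y of X in which every valence is at least 2 and those vertices have
    the full valence 2k. Summing valences, Y has at least (k - 1)(L - 2) more
    edges than vertices. On the other hand the number of edges minus the number
    of vertices of a finite subgraph is at most r - 1, since H^1 of X with
    coefficients in Z/2 is Hom(A, Z/2) and has dimension at most r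
    ([edges_le_rank]). Comparing the two gives the bound; for L = 2, when Y may
    be empty, it says that [A] is not trivial ([bichrome_loops]). *)

Set Implicit Arguments.
Unset Strict Implicit.
Unset Printing Implicit Defensive.

Local Open Scope group_scope.

(** * Evaluation of words in the free group *)

Section Words.

Variable k : nat.
Implicit Types (a b l : letter k) (u v w z : seq (letter k)).
Implicit Types (g x y t : free_group k).

Definition eval w : free_group k := FreeGroup (reduce_reduced w).

Definition elt a : free_group k := eval [:: a].

Lemma eval_cat u v : eval (u ++ v) = eval u * eval v.
Proof. by apply: val_inj; rewrite /= reduce_catl reduce_catr. Qed.

Lemma eval_cons a w : eval (a :: w) = elt a * eval w.
Proof. by rewrite -cat1s eval_cat. Qed.

Lemma eval_rcons w a : eval (rcons w a) = eval w * elt a.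
Proof. by rewrite -cats1 eval_cat. Qed.

Lemma eval_nil : eval [::] = 1.
Proof. exact: val_inj. Qed.

Lemma eval_word x : eval (word x) = x.
Proof. by apply: val_inj; rewrite /= reduce_id // word_reduced. Qed.

Lemma word_eval w : reduced w -> word (eval w) = w.
Proof. exact: reduce_id. Qed.

Lemma eval_inv w : eval (inv_word w) = (eval w)^-1.
Proof.
apply: (@mulgI _ (eval w)); rewrite mulgV -eval_cat.
by apply: val_inj; rewrite /= reduce_inv_word.
Qed.

Lemma elt_inv a : elt (letter_inv a) = (elt a)^-1.
Proof. by rewrite -eval_inv. Qed.

Lemma eval_reduce w : eval (reduce w) = eval w.
Proof. by apply: val_inj; rewrite /= reduce_id // reduce_reduced. Qed.

Lemma size_reduce w : size (reduce w) <= size w.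
Proof.
elim: w => //= a w IH; apply: leq_trans (_ : (size (reduce w)).+1 <= _) => //.
by case: (reduce w) => [|b v] //=; case: ifP => //= _; apply: ltnW.
Qed.

Lemma no_cancel_self a : no_cancel a a.
Proof. by case: a => i []; rewrite /no_cancel /letter_inv /eq_op /= andbF. Qed.

Lemma no_cancel_inv a b : no_cancel (letter_inv a) b = (b != a).
Proof. by rewrite /no_cancel letter_invK. Qed.

Lemma reduced_rcons2 w a b :
  reduced (rcons (rcons w a) b) = reduced (rcons w a) && no_cancel a b.
Proof. by case: w => [|c w]; rewrite /reduced /= ?andbT // rcons_path last_rcons. Qed.

Lemma reduced_cat2 u a b v :
  reduced (rcons u a ++ b :: v) =
  [&& reduced (rcons u a), no_cancel a b & reduced (b :: v)].
Proof.
rewrite /reduced; case: u => [|c u] //=.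
by rewrite cat_path last_rcons /=.
Qed.

Lemma reduced_catr u v : reduced (u ++ v) -> reduced v.
Proof. by case/cat_sorted2. Qed.

Lemma inv_word_rcons w a : inv_word (rcons w a) = letter_inv a :: inv_word w.
Proof. by rewrite /inv_word map_rcons rev_rcons. Qed.

Lemma inv_word_cons w a : inv_word (a :: w) = rcons (inv_word w) (letter_inv a).
Proof. by rewrite /inv_word map_cons rev_cons. Qed.

Lemma size_inv_word w : size (inv_word w) = size w.
Proof. by rewrite size_rev size_map. Qed.

Lemma reduced_nseq n a : reduced (nseq n a).
Proof.
by case: n => //= n; elim: n => //= n ->; rewrite no_cancel_self.
Qed.

Lemma reduced_extend w a n : reduced (rcons w a) -> reduced (rcons w a ++ nseq n a).
Proof.
case: n => [|n] Hw; first by rewrite cats0.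
by rewrite reduced_cat2 Hw no_cancel_self; apply: (reduced_nseq n.+1).
Qed.

Definition wpow w n := flatten (nseq n w).

Lemma eval_wpow w n : eval (wpow w n) = eval w ^+ n.
Proof.
elim: n => [|n IH]; first exact: eval_nil.
by rewrite /wpow /= eval_cat IH expgS.
Qed.

Lemma size_wpow w n : size (wpow w n) = (n * size w)%N.
Proof. by elim: n => //= n IH; rewrite size_cat -/(wpow w n) IH mulSn. Qed.

Lemma wpow_reduced w n : cyclically_reduced w -> reduced (wpow w n).
Proof.
case: w => [|a w]; first by elim: n.
rewrite /cyclically_reduced /= => Hc.
have Hr : reduced (a :: w) by move: Hc; rewrite rcons_path => /andP[].
have Hl : no_cancel (last a w) a by move: Hc; rewrite rcons_path => /andP[].
elim: n => [|[|n] IH] //; first by rewrite /wpow /= cats0.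
have -> : wpow (a :: w) n.+2 = (a :: w) ++ wpow (a :: w) n.+1 by [].
have {IH}: reduced (wpow (a :: w) n.+1) by [].
have -> : wpow (a :: w) n.+1 = a :: (w ++ wpow (a :: w) n) by [].
by rewrite {2}(lastI a w) reduced_cat2 -lastI Hr Hl.
Qed.

Lemma cyclically_reduced_inv w :
  cyclically_reduced w -> cyclically_reduced (inv_word w).
Proof.
rewrite /cyclically_reduced /inv_word rev_cycle.
case: w => //= a w; rewrite -map_rcons path_map.
by apply: sub_path => b c; rewrite /= no_cancel_inv eq_sym.
Qed.

Lemma cyclically_reduced_catC u v :
  cyclically_reduced (u ++ v) -> cyclically_reduced (v ++ u).
Proof. by rewrite /cyclically_reduced -rot_size_cat rot_cycle. Qed.

Lemma free_ind (P : free_group k -> Prop) :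
  P 1 -> (forall a x, P x -> P (elt a * x)) -> forall x, P x.
Proof.
move=> P1 PM x; rewrite -(eval_word x).
elim: (word x) => [|a w IH]; first by rewrite eval_nil.
by rewrite eval_cons; apply: PM.
Qed.

End Words.

(** * Cosets of a subgroup and finite bounds *)

Record subgroup_pred (G : groupType) (A : G -> Prop) : Prop := SubgroupPred {
  subgroup1 : A 1;
  subgroupM : forall x y, A x -> A y -> A (x * y);
  subgroupV : forall x, A x -> A x^-1
}.

Definition same_coset (G : groupType) (A : G -> Prop) (x y : G) : Prop := A (x / y).

Lemma fin_bound (T : finType) (P : T -> nat -> Prop) :
  (forall t, exists N, forall n, N <= n -> P t n) ->
  exists N, forall n t, N <= n -> P t n.
Proof.
move=> /choice[f Hf]; exists (\max_t f t) => n t Hn.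
by apply: Hf; apply: leq_trans Hn; apply: leq_bigmax.
Qed.

Lemma seq_bound (T : eqType) (D : seq T) (P : T -> nat -> Prop) :
  (forall t, exists N, forall n, N <= n -> P t n) ->
  exists N, forall n t, t \in D -> N <= n -> P t n.
Proof.
move=> HP; elim: D => [|d D [N HN]]; first by exists 0%N.
have [M HM] := HP d; exists (maxn M N) => n t.
rewrite inE geq_max => /orP[/eqP->|Ht] /andP[HMn HNn]; first exact: HM.
exact: HN.
Qed.

Section Cosets.

Variables (G : groupType) (A : G -> Prop).
Hypothesis HA : subgroup_pred A.
Implicit Types x y z : G.

Lemma same_refl x : same_coset A x x.
Proof. by rewrite /same_coset mulgV; apply: subgroup1. Qed.

Lemma same_sym x y : same_coset A x y -> same_coset A y x.
Proof. by move=> /(subgroupV HA); rewrite invgF. Qed.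

Lemma same_trans y x z : same_coset A x y -> same_coset A y z -> same_coset A x z.
Proof. by move=> Hxy /(subgroupM HA Hxy); rewrite mulgA mulgVK. Qed.

Lemma same_mulr z x y : same_coset A (x * z) (y * z) <-> same_coset A x y.
Proof. by rewrite /same_coset mulgKA. Qed.

(** Each coset is met by at most one index, so the sizes of the finitely many
    offending indices are bounded. *)
Lemma escape (I : Type) (P : I -> Prop) (s : I -> G) (sz : I -> nat) (D : seq G) :
  (forall i j, P i -> P j -> same_coset A (s i) (s j) -> i = j) ->
  exists N, forall i, P i -> N <= sz i -> forall d, d \in D -> ~ same_coset A (s i) d.
Proof.
move=> inj_s.
have [|N HN] := @seq_bound G D (fun d n => forall i, P i -> n <= sz i ->
    ~ same_coset A (s i) d).
  move=> d; have [[i [Pi Hi]]|Hno] := pselect (exists i, P i /\ same_coset A (s i) d).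
    exists (sz i).+1 => n Hn j Pj Hj Hjd; have ij : i = j.
      by apply: inj_s => //; apply: same_trans Hi (same_sym Hjd).
    by rewrite ij in Hn; rewrite ltnNge Hj in Hn.
  by exists 0%N => n _ i Pi _ Hi; apply: Hno; exists i.
by exists N => i Pi Hi d Hd; apply: HN (leqnn N) i Pi Hi.
Qed.

End Cosets.

(** * Exits of the coset graph *)

Section Exits.

Variables (k : nat) (A : free_group k -> Prop).
Hypothesis HA : subgroup_pred A.
Implicit Types (a b l : letter k) (u v w z : seq (letter k)).
Implicit Types (g x y t : free_group k).

(** The edge of the coset graph that leaves [g] along [a] is an exit when this
    fails. *)
Definition loops_from g a : Prop :=
  exists u, reduced (a :: u) /\ same_coset A (g * eval (a :: u)) g.

Lemma loops_from_same g g' a : same_coset A g g' -> loops_from g a -> loops_from g' a.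
Proof.
move=> Hg [u [Hu Hgu]]; exists u; split=> //.
apply: (same_trans HA _ Hg); apply: (same_trans HA _ Hgu).
by apply/same_mulr; apply: same_sym.
Qed.

(** Conjugating by [a] a loop that starts with [b] gives a loop whose reduced
    word still starts with [a]: at most its last letter cancels. *)
Lemma exit_step g a b :
  ~ loops_from g a -> no_cancel a b -> ~ loops_from (g * elt a) b.
Proof.
move=> Hga Hab [u [Hu Hgu]]; apply: Hga.
have Hau : reduced (a :: b :: u) by rewrite /reduced /= Hab.
move: Hau Hgu {Hu Hab}; rewrite (lastI b u).
move: (belast b u) (last b u) => y c Hau Hgu.
have [ca|ca] := eqVneq c a.
  exists y; split.
    by move: Hau; rewrite /reduced /= rcons_path => /andP[].
  apply/(same_mulr A (elt a)); rewrite eval_cons.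
  by rewrite eval_rcons ca in Hgu; rewrite !mulgA in Hgu *.
exists (rcons (rcons y c) (letter_inv a)); split.
  rewrite -rcons_cons -rcons_cons reduced_rcons2 rcons_cons Hau /=.
  by rewrite /no_cancel (inj_eq (can_inj (@letter_invK k))) eq_sym.
apply/(same_mulr A (elt a)).
by rewrite eval_cons eval_rcons elt_inv !mulgA mulgVK.
Qed.

(** The coset graph is a tree beyond an exit. Two different reduced words with
    the same end would, after removal of a common suffix, either form a reduced
    loop through the exit or differ by a loop that starts just beyond it. *)
Lemma exit_inj g a w w' : ~ loops_from g a -> reduced (a :: w) -> reduced (a :: w') ->
  same_coset A (g * eval (a :: w)) (g * eval (a :: w')) -> w = w'.
Proof.
move=> Hga; elim/last_ind: w w' => [|w c IH] w'.
  case: w' => // b w' _; rewrite {1}/reduced /= => /andP[Hab Hw] Hs; exfalso.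
  apply: (exit_step Hga Hab); exists w'; split=> //.
  by apply: same_sym => //; move: Hs; rewrite (eval_cons a (b :: w')) mulgA.
case/lastP: w' => [|w' d].
  case: w IH => [|b w] IH; rewrite ?rcons_cons {1}/reduced /= => /andP[Hab Hw] _ Hs;
    exfalso; apply: (exit_step Hga Hab); [exists [::] | exists (rcons w c)];
    by split=> //; move: Hs; rewrite eval_cons mulgA.
move=> Hw Hw'; have [<-|cd] := eqVneq c d.
  move=> Hs; congr rcons; apply: IH.
  - by move: Hw; rewrite /reduced /= rcons_path => /andP[].
  - by move: Hw'; rewrite /reduced /= rcons_path => /andP[].
  by move: Hs; rewrite -!rcons_cons !eval_rcons !mulgA => /same_mulr.
move=> Hs; case: Hga.
exists (rcons w c ++ inv_word (a :: rcons w' d)); split.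
  rewrite -rcons_cons inv_word_rcons -cat_cons -rcons_cons reduced_cat2 rcons_cons Hw.
  rewrite -inv_word_rcons rcons_cons (inv_word_reduced Hw') andbT.
  by rewrite /no_cancel (inj_eq (can_inj (@letter_invK k))) eq_sym.
apply/(same_mulr A (eval (a :: rcons w' d))).
by rewrite -cat_cons eval_cat eval_inv mulgA mulgVK.
Qed.

End Exits.

(** * Colourings of the ends of the coset graph *)

(** Combinatorial trace of a splitting over [A] relative to [h]. It is stated
    for the elements of the free group rather than for an action, so that trees
    can be forgotten until the last part. In [color_elliptic] the colour [b] is
    that of a point fixed by the conjugate [s * h / s]. *)
Record elliptic_coloring (k : nat) (A : free_group k -> Prop) (h : free_group k)
    (c : free_group k -> bool) : Prop := EllipticColoring {
  color_same : forall x y, same_coset A x y -> c x = c y;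
  color_boundary : forall y, exists D : seq (free_group k),
    forall g, c g != c (g * y) -> exists2 d, d \in D & same_coset A g d;
  color_elliptic : forall s x, exists b, exists D : seq (free_group k),
    forall n g, g = (s * h / s) ^+ n \/ g = (s * h / s) ^- n ->
    c (g * x) != b -> exists2 d, d \in D & same_coset A g d;
  color_infinite : forall b (D : seq (free_group k)),
    exists2 x, c x = b & forall d, d \in D -> ~ same_coset A x d
}.

Section Colors.

Variables (k L : nat) (A : free_group k -> Prop) (h : free_group k).
Variable c : free_group k -> bool.
Hypothesis HA : subgroup_pred A.
Hypothesis Hc : elliptic_coloring A h c.
Hypothesis L_ge2 : 2 <= L.
Hypothesis h_cyc : cyclically_reduced (word h).
Hypothesis h_all :
  forall w : seq (letter k), reduced w -> size w = L -> infix w (word h).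
Implicit Types (a l : letter k) (u v w z p : seq (letter k)).
Implicit Types (g x y t : free_group k) (b : bool).

(** The colour is prescribed only far from the exit, that is, on the ends of the
    tree behind it. *)
Definition ends_color g a b : Prop :=
  exists N, forall w, reduced (a :: w) -> N <= size w -> c (g * eval (a :: w)) = b.

Lemma ends_color_same g g' a b :
  same_coset A g g' -> ends_color g a b -> ends_color g' a b.
Proof.
move=> Hg [N HN]; exists N => w Hw Nw; rewrite -(HN w Hw Nw).
by apply: (color_same Hc); apply/same_mulr; apply: same_sym.
Qed.

Lemma ends_color_step g a l b :
  ends_color g a b -> no_cancel a l -> ends_color (g * elt a) l b.
Proof.
case=> N HN Hal; exists N => w Hw Nw; rewrite -mulgA -eval_cons; apply: HN.
  by rewrite /reduced /= Hal.
exact: leqW.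
Qed.

Lemma ends_color_unique g a b b' : ends_color g a b -> ends_color g a b' -> b = b'.
Proof.
move=> [N HN] [M HM]; have Hr := reduced_nseq (maxn N M).+1 a.
by rewrite -(HN _ Hr) ?(HM _ Hr) // size_nseq ?leq_maxl ?leq_maxr.
Qed.

(** The prescribed word is prolonged to length [L] and located in [h]; rotating
    [h] brings it to the front. *)
Lemma conj_through p a a' : reduced (letter_inv a :: rcons p a') ->
    (size p).+2 <= L ->
  exists w s, let h1 := letter_inv a :: p ++ a' :: w in
    cyclically_reduced h1 /\ h = eval s * eval h1 / eval s.
Proof.
move=> Hq HL; set q := letter_inv a :: rcons p a'.
have Hs : size (q ++ nseq (L - size q) a') = L.
  by rewrite size_cat size_nseq subnKC // /q /= size_rcons.
have := h_all (@reduced_extend k (letter_inv a :: p) a' (L - size q) Hq) Hs.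
case/infixP=> s [z Hh]; exists (nseq (L - size q) a' ++ z ++ s), s; cbv zeta.
have -> : letter_inv a :: p ++ a' :: nseq (L - size q) a' ++ z ++ s =
    ((q ++ nseq (L - size q) a') ++ z) ++ s.
  by rewrite /q /= -!catA cat_rcons.
have := h_cyc; rewrite Hh; set q' := q ++ _ in Hh * => Hcyc.
split; first exact: cyclically_reduced_catC.
by rewrite -(eval_word h) Hh (eval_cat (q' ++ z)) !eval_cat !mulgA mulgK.
Qed.

(** The reduced path from one exit to the other is part of the axis of a
    conjugate of [h]. The ends of this axis lie behind the exits, where the
    coset graph is a tree, so no non-trivial power of the conjugate lies in [A]. Hence both ends
    carry the colour of the side that contains a point fixed by the conjugate. *)
Lemma exit_connect g a p a' b b' : ~ loops_from A g a -> ends_color g a b ->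
  ends_color (g * eval p) a' b' -> reduced (letter_inv a :: rcons p a') ->
  (size p).+2 <= L -> b = b'.
Proof.
move=> Hga [N HN] [N' HN'] Hr HL.
have [w [s [Hcyc Hh]]] := conj_through Hr HL; move: Hcyc Hh.
set h1 := letter_inv a :: p ++ a' :: w => Hcyc Hh.
have [x Ex] : exists x, x = g * elt a by exists (g * elt a).
pose s' := x / eval s; pose t := s' * h / s'.
(* [x * eval h1 ^+ n], for n in Z, are the points of the axis of [t]. Its
   negative half starts along [a] at [g], behind the first exit. *)
have Et : t = x * eval h1 / x.
  rewrite /t /s' Hh invgF !mulgA.
  by rewrite !mulgVK.
have Etn n : t ^+ n * x = x * eval h1 ^+ n.
  elim: n => [|n IH]; first by rewrite !expg0 mul1g mulg1.
  rewrite !expgS -mulgA IH Et !mulgA.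
  by rewrite mulgVK.
pose W := wpow (inv_word h1).
have EtVn n : t ^- n * x = g * eval (a :: W n).
  rewrite eval_cons eval_wpow eval_inv mulgA -Ex expVgn.
  apply: (@mulgI _ (t ^+ n)); rewrite mulgA mulgV mul1g.
  by rewrite mulgA Etn mulgK.
have redW n : reduced (a :: W n).
  have := wpow_reduced n.+1 (cyclically_reduced_inv Hcyc).
  have -> : wpow (inv_word h1) n.+1 = inv_word (p ++ a' :: w) ++ a :: W n.
    by rewrite -cat_rcons -[a]letter_invK -inv_word_cons.
  exact: reduced_catr.
have h1_gt0 : 0 < size h1 by [].
have inj_neg n m : same_coset A (t ^- n) (t ^- m) -> n = m.
  move/(same_mulr A x); rewrite !EtVn => /(exit_inj HA Hga (redW n) (redW m)).
  move/(congr1 size); rewrite !size_wpow size_inv_word => /eqP.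
  by rewrite eqn_pmul2r // => /eqP.
have inj_pos n m : same_coset A (t ^+ n) (t ^+ m) -> n = m.
  move=> Hnm; apply/esym/inj_neg; rewrite /same_coset invgK.
  suff -> : t ^- m * t ^+ n = t ^+ n / t ^+ m by [].
  by apply/esym/commuteV/commuteX2.
have [b0 [D HD]] := color_elliptic Hc s' x.
(* The powers of [t] lie in pairwise different cosets, so only finitely many of
   them move [x] to a point whose colour is not that of the fixed point. *)
have [N1 HN1] := @escape _ A HA nat (fun=> True) (fun n => t ^- n) id D
  (fun i j _ _ => @inj_neg i j).
have [N2 HN2] := @escape _ A HA nat (fun=> True) (fun n => t ^+ n) id D
  (fun i j _ _ => @inj_pos i j).
pose n := (maxn (maxn N1 N2) (maxn N N')).+1.
have [n1 [n2 [nN nN']]] : N1 <= n /\ N2 <= n /\ N <= n /\ N' < n.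
  by split; [|split; [|split]]; rewrite /n ?ltnS ?leqW // !leq_max leqnn ?orbT.
have cneg : c (t ^- n * x) = b0.
  apply: contrapT => /eqP Hb; have [|d dD Hd] := HD n (t ^- n) _ Hb; first by right.
  by apply: (HN1 n _ n1 d).
have cpos : c (t ^+ n * x) = b0.
  apply: contrapT => /eqP Hb; have [|d dD Hd] := HD n (t ^+ n) _ Hb; first by left.
  by apply: (HN2 n _ n2 d).
have leS m : m <= m * size h1 by rewrite leq_pmulr.
rewrite -(HN (W n)) // -?EtVn ?cneg; last first.
  by rewrite size_wpow size_inv_word; apply: leq_trans (leS n).
rewrite -cpos Etn -eval_wpow; case: (n) nN' => // m HmN'.
have -> : wpow h1 m.+1 = letter_inv a :: p ++ a' :: (w ++ wpow h1 m).
  by rewrite {1}/wpow /= -/(wpow _ _) -catA.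
rewrite Ex eval_cons elt_inv mulgA mulgK eval_cat mulgA HN' //.
  have := wpow_reduced m.+1 Hcyc.
  have -> : wpow h1 m.+1 = (letter_inv a :: p) ++ a' :: (w ++ wpow h1 m).
    by rewrite {1}/wpow /= -/(wpow _ _) -catA.
  by move/reduced_catr.
rewrite size_cat size_wpow; apply: leq_trans (leq_addl _ _).
by apply: leq_trans (leS m).
Qed.

(** Far from the exit the colour is constant along paths. Going back towards the
    exit, the subtrees that branch off at one vertex are joined through that
    vertex by words of length 2, so they have the same colour by
    [exit_connect]. *)
Lemma exit_ends_color g a : ~ loops_from A g a -> exists b, ends_color g a b.
Proof.
move=> Hga.
have [D HD] : exists D : seq (free_group k), forall g l,
    c g != c (g * elt l) -> exists2 d, d \in D & same_coset A g d.
  have /choice[D HD] := fun l => color_boundary Hc (elt l).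
  exists (flatten [seq D l | l : letter k]) => g0 l /HD[d dD Hd].
  by exists d => //; apply/flatten_mapP; exists l; rewrite ?mem_enum.
have [m Hm] := @escape _ A HA (seq (letter k)) (fun w => reduced (a :: w))
  (fun w => g * eval (a :: w)) size D (fun i j => @exit_inj k A HA g a i j Hga).
have {HD D} Hm w l : reduced (a :: w) -> m <= size w ->
    c (g * eval (a :: w) * elt l) = c (g * eval (a :: w)).
  move=> Hw Hmw; apply/esym/eqP; apply: contrapT => /negP/HD[d dD Hd].
  exact: Hm Hd.
elim: m g a Hga Hm => [|m IH] g a Hga Hm.
  exists (c (g * eval [:: a])), 0%N => w + _; elim/last_ind: w => // w l IHw Hw.
  have Hw' : reduced (a :: w).
    by move: Hw; rewrite /reduced /= rcons_path => /andP[].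
  by rewrite -rcons_cons eval_rcons mulgA Hm // IHw.
(* Each of the subtrees that branch off just beyond [a] is monochromatic by
   induction; the one that continues along [a] serves as a reference. *)
have Hstep l : no_cancel a l -> exists b, ends_color (g * elt a) l b.
  move=> Hal; apply: IH => [|w i Hw Hmw]; first exact: exit_step Hal.
  by rewrite -(mulgA g (elt a)) -eval_cons; apply: Hm => //; rewrite /reduced /= Hal.
have [b Hb] := Hstep a (no_cancel_self a); exists b.
have [|N HN] := @fin_bound (letter k) (fun l n => no_cancel a l ->
    forall w, reduced (l :: w) -> n <= size w -> c (g * elt a * eval (l :: w)) = b).
  move=> l; have [Hal|] := boolP (no_cancel a l); last by exists 0%N.
  have [b' Hb'] := Hstep l Hal.
  have bb' : b = b'.
    have [la|la] := eqVneq l a; first by rewrite la in Hb'; apply: ends_color_unique Hb Hb'.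
    apply: (@exit_connect (g * elt a) a [::] l) => //.
    - exact: (exit_step Hga (no_cancel_self a)).
    - by rewrite eval_nil mulg1.
    by rewrite /reduced /= no_cancel_inv la.
  case: Hb' => N HN; exists N => n Nn _ w Hw nw; rewrite bb'; apply: HN => //.
  exact: leq_trans nw.
exists N.+1 => -[|l w] //; rewrite /reduced /= => /andP[Hal Hw] Nw.
by rewrite eval_cons mulgA; apply: (HN N).
Qed.

End Colors.

(** * Exits of both colours exist *)

Definition generated_by (G : groupType) (I : Type) (gens : I -> G)
    (A : G -> Prop) : Prop :=
  (forall i, A (gens i)) /\
  forall P, subgroup_pred P -> (forall i, P (gens i)) -> forall x, A x -> P x.

Section Reading.

Variables (k r : nat) (A : free_group k -> Prop) (gens : 'I_r -> free_group k).
Hypothesis HA : subgroup_pred A.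
Hypothesis Hgens : generated_by gens A.
Implicit Types (a l : letter k) (u v w z : seq (letter k)).
Implicit Types (g x y t : free_group k).

(** The edges of the finite subgraph of the coset graph that is traversed when
    the generators are read from the base vertex, in both directions. *)
Definition gen_edge g l : Prop := exists i u v,
  (word (gens i) = u ++ l :: v /\ same_coset A g (eval u)) \/
  (word (gens i) = u ++ letter_inv l :: v /\ same_coset A (g * elt l) (eval u)).

Fixpoint reads g w : Prop :=
  if w is l :: w' then gen_edge g l /\ reads (g * elt l) w' else True.

Lemma gen_edge_same g g' l : same_coset A g g' -> gen_edge g l -> gen_edge g' l.
Proof.
move=> /(same_sym HA) Hg [i [u [v [[Hw Hu]|[Hw Hu]]]]]; exists i, u, v.
  by left; split=> //; apply: same_trans Hu.
by right; split=> //; apply: same_trans Hu => //; apply/same_mulr.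
Qed.

Lemma gen_edge_sym g l : gen_edge g l -> gen_edge (g * elt l) (letter_inv l).
Proof.
move=> [i [u [v [[Hw Hu]|[Hw Hu]]]]]; exists i, u, v; last by left.
by right; rewrite letter_invK elt_inv mulgK.
Qed.

Lemma reads_same g g' w : same_coset A g g' -> reads g w -> reads g' w.
Proof.
elim: w g g' => [|l w IH] g g' Hg //= [Hl Hw]; split.
  exact: gen_edge_same Hl.
by apply: IH Hw; apply/same_mulr.
Qed.

Lemma reads_cat g u v : reads g (u ++ v) <-> reads g u /\ reads (g * eval u) v.
Proof.
elim: u g => [|l u IH] g /=; first by rewrite eval_nil mulg1; tauto.
by rewrite IH (eval_cons l) mulgA; tauto.
Qed.

(** A cancellation only removes a backtracking. *)
Lemma reads_reduce g w : reads g w -> reads g (reduce w).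
Proof.
elim: w g => //= a w IH g [Ha /IH].
case: (reduce w) => [|b v] //= [Hb Hv].
case: eqP => [ba|_]; last by [].
by move: Hv; rewrite ba elt_inv mulgK.
Qed.

Lemma reads_inv g w : reads g w -> reads (g * eval w) (inv_word w).
Proof.
elim: w g => //= l w IH g [Hl /IH Hw].
rewrite inv_word_cons -cats1 eval_cons mulgA; apply/reads_cat; split=> //=.
by rewrite eval_inv mulgK; split=> //; apply: gen_edge_sym.
Qed.

Lemma reads_gen i : reads 1 (word (gens i)).
Proof.
suff H u v : word (gens i) = u ++ v -> reads (eval u) v.
  by have := H [::] _ erefl; rewrite eval_nil.
elim: v u => //= l v IH u Huv; split.
  by exists i, u, v; left; split=> //; apply: same_refl.
by rewrite -eval_rcons; apply: IH; rewrite cat_rcons.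
Qed.

Lemma reads_sub x : A x -> reads 1 (word x).
Proof.
move=> Ax; suff [] : A x /\ reads 1 (word x) by [].
case: Hgens => HgA /(_ (fun x => A x /\ reads 1 (word x))); apply=> //.
  split=> [|y z [Ay Hy] [Az Hz]|y [Ay Hy]].
  - by split=> //; apply: subgroup1.
  - split; first exact: subgroupM.
    apply: reads_reduce; apply/reads_cat; split=> //.
    by rewrite eval_word mul1g; apply: reads_same Hz; rewrite /same_coset div1g; apply: subgroupV.
  split; first exact: subgroupV.
  have := reads_inv Hy; rewrite eval_word mul1g => H.
  by apply: reads_same H; rewrite /same_coset divg1.
by move=> i; split=> //; apply: reads_gen.
Qed.

(** A loop at the end of [w] is conjugate, through [w], to an element of [A].
    Both [w] and this element are read inside the subgraph of the generators,
    hence so is the reduced word of the loop. *)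
Lemma leave_exit w l : reads 1 w -> ~ gen_edge (eval w) l -> ~ loops_from A (eval w) l.
Proof.
move=> Hw Hl [u [Hu Hs]]; apply: Hl.
set y := eval w in Hs *; set t := y * eval (l :: u) / y.
have Ht : reads 1 (word t) by apply: reads_sub.
have : reads y (inv_word w ++ word t ++ w).
  apply/reads_cat; split; first by have := reads_inv Hw; rewrite mul1g.
  rewrite eval_inv mulgV; apply/reads_cat; split=> //.
  rewrite mul1g eval_word; apply: reads_same Hw.
  by apply: same_sym => //; rewrite /same_coset divg1.
move/reads_reduce; have -> : reduce (inv_word w ++ word t ++ w) = l :: u.
  rewrite -[RHS](word_eval Hu).
  have -> : eval (l :: u) = eval (inv_word w ++ word t ++ w) by
    rewrite !eval_cat eval_inv eval_word -/y /t !mulgA mulVg mul1g mulgVK.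
  by [].
by case.
Qed.

Lemma finite_core : exists D : seq (free_group k), forall g l,
  gen_edge g l -> exists2 d, d \in D & same_coset A g d.
Proof.
pose D i := [seq eval (take n (word (gens i))) | n <- iota 0 (size (word (gens i))).+1].
exists (flatten [seq D i | i : 'I_r]) => g l [i [u [v [[Hw Hu]|[Hw Hu]]]]].
  exists (eval u) => //; apply/flatten_mapP; exists i; rewrite ?mem_enum //.
  apply/mapP; exists (size u); last by rewrite Hw take_size_cat.
  by rewrite mem_iota Hw size_cat add0n ltnS leq_addr.
exists (eval (rcons u (letter_inv l))).
  apply/flatten_mapP; exists i; rewrite ?mem_enum //.
  apply/mapP; exists (size u).+1.
    by rewrite mem_iota Hw size_cat /= add0n ltnS addnS ltnS leq_addr.
  by rewrite Hw -cat_rcons take_size_cat // size_rcons.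
by apply/(same_mulr A (elt l)); rewrite eval_rcons elt_inv mulgVK.
Qed.

Fixpoint words_upto n : seq (seq (letter k)) :=
  if n is n'.+1 then [::] :: [seq a :: w | a <- enum {: letter k}, w <- words_upto n']
  else [:: [::]].

Lemma mem_words_upto n w : size w <= n -> w \in words_upto n.
Proof.
elim: n w => [|n IH] [|a w] //= Hw; rewrite inE.
by apply/allpairsP; exists (a, w); rewrite /= mem_enum IH.
Qed.

Variables (L : nat) (h : free_group k) (c : free_group k -> bool).
Hypothesis Hc : elliptic_coloring A h c.
Hypothesis L_ge2 : 2 <= L.
Hypothesis h_cyc : cyclically_reduced (word h).
Hypothesis h_all :
  forall w : seq (letter k), reduced w -> size w = L -> infix w (word h).

(** Otherwise all exits have the other colour. A vertex of colour [b] then lies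
    in the finite subgraph of the generators or at bounded distance behind one
    of the finitely many exits out of it, so there are only finitely many. *)
Lemma exit_of_color b : exists g a, ~ loops_from A g a /\ ends_color c g a b.
Proof.
apply: contrapT => Hno.
have Hcol g a : ~ loops_from A g a -> ends_color c g a (~~ b).
  move=> Hga; have [b' Hb'] := exit_ends_color HA Hc L_ge2 h_cyc h_all Hga.
  have [bb|bb] := eqVneq b' b; first by case: Hno; exists g, a; rewrite -bb.
  by move: bb Hb'; case: b'; case: (b).
have [D HD] := finite_core.
have [|N HN] := @seq_bound _ (1 :: D) (fun d n => forall l w, ~ loops_from A d l ->
    reduced (l :: w) -> n <= size w -> c (d * eval (l :: w)) = ~~ b).
  move=> d; have [|N HN] := @fin_bound (letter k) (fun l n => forall w,
      ~ loops_from A d l -> reduced (l :: w) -> n <= size w -> c (d * eval (l :: w)) = ~~ b).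
    move=> l; have [Hl|Hl] := pselect (loops_from A d l); first by exists 0%N.
    have [N HN] := Hcol d l Hl; exists N => n Nn w _ Hw Hn; apply: HN => //.
    exact: leq_trans Hn.
  by exists N => n Nn l w; apply: HN.
have {}HN d l w dD := HN N d dD (leqnn N) l w.
pose D1 := [seq d * eval z | d <- 1 :: D, z <- words_upto N.+1].
have [x cx Hx] := color_infinite Hc b D1.
have HD1 d z y : d \in 1 :: D -> size z <= N.+1 ->
    same_coset A y d -> ~ same_coset A x (y * eval z).
  move=> dD Hz Hy Hxy; apply: (Hx (d * eval z)).
    by apply/allpairsP; exists (d, z); split=> //; apply: mem_words_upto.
  by apply: same_trans Hxy _ => //; apply/same_mulr.
have Hread w : reads 1 w -> exists2 d, d \in 1 :: D & same_coset A (eval w) d.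
  case/lastP: w => [|w l]; first by exists 1; rewrite ?mem_head ?eval_nil //; apply: same_refl.
  rewrite -cats1 => /reads_cat[_ /= [Hl _]]; rewrite mul1g in Hl.
  have [d dD Hd] := HD _ _ (gen_edge_sym Hl); exists d; first by rewrite inE dD orbT.
  by rewrite eval_cat.
(* The reduced word of [x] is followed until it leaves the finite subgraph. *)
suff H w z : reduced (w ++ z) -> reads 1 w -> eval (w ++ z) = x -> False.
  by apply: (H [::] (word x)); rewrite ?eval_word //= word_reduced.
elim: z w => [|l z IH] w Hr Hw Hwx.
  have [d dD Hd] := Hread w Hw.
  apply: (HD1 d [::] (eval w)) => //.
  by rewrite eval_nil mulg1 -Hwx cats0; apply: same_refl.
have [Hl|Hl] := pselect (gen_edge (eval w) l).
  apply: (IH (rcons w l)); rewrite ?cat_rcons //.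
  by rewrite -cats1; apply/reads_cat; rewrite /= mul1g.
have Hex := leave_exit Hw Hl; have [d dD Hd] := Hread w Hw.
have [Hz|Hz] := leqP N (size z).
  have : c (d * eval (l :: z)) = ~~ b.
    apply: HN => //; last exact: reduced_catr Hr.
    by move=> Hd'; apply: Hex; apply: loops_from_same Hd' => //; apply: same_sym.
  have -> : c (d * eval (l :: z)) = c x.
    apply: (color_same Hc); rewrite -Hwx eval_cat.
    by apply/same_mulr; apply: same_sym.
  by rewrite cx; case: (b).
apply: (HD1 d (l :: z) (eval w)) => //=; first exact: ltnW.
by rewrite -eval_cat Hwx; apply: same_refl.
Qed.

End Reading.

(** * A shortest path between exits of different colours *)

Section Separation.

Variables (k L : nat) (A : free_group k -> Prop) (h : free_group k).
Variable c : free_group k -> bool.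
Hypothesis HA : subgroup_pred A.
Hypothesis Hc : elliptic_coloring A h c.
Hypothesis L_ge2 : 2 <= L.
Hypothesis h_cyc : cyclically_reduced (word h).
Hypothesis h_all :
  forall w : seq (letter k), reduced w -> size w = L -> infix w (word h).
Hypothesis exits : forall b, exists g a, ~ loops_from A g a /\ ends_color c g a b.
Implicit Types (a l : letter k) (u v w z p : seq (letter k)).
Implicit Types (g x y t : free_group k) (b : bool).

Definition exit_color g a b := ~ loops_from A g a /\ ends_color c g a b.

(** The path [p] may backtrack, and it may overlap the exits at its ends; the
    shortest such path does neither. *)
Definition bichrome p g := exists a a' b,
  exit_color g a b /\ exit_color (g * eval p) a' (~~ b).

Lemma exit_color_same g g' a b :
  same_coset A g g' -> exit_color g a b -> exit_color g' a b.
Proof.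
move=> Hg [Hw Hm]; split; last exact: (ends_color_same HA Hc Hg).
by move=> Hw'; apply: Hw; apply: loops_from_same Hw' => //; apply: same_sym.
Qed.

Lemma exit_color_step g a l b :
  exit_color g a b -> no_cancel a l -> exit_color (g * elt a) l b.
Proof.
by move=> [Hw Hm] Hal; split; [apply: exit_step Hal | apply: ends_color_step Hal].
Qed.

Lemma minimal_bichrome : exists p g, [/\ bichrome p g, reduced p &
  forall p' g', bichrome p' g' -> size p <= size p'].
Proof.
have Hex : exists n, `[< exists p g, size p = n /\ bichrome p g >].
  have [g [a Hg]] := exits true; have [g' [a' Hg']] := exits false.
  exists (size (word (g^-1 * g'))); apply/asboolP; exists (word (g^-1 * g')), g.
  by split=> //; exists a, a', true; rewrite eval_word mulVKg.
case: (ex_minnP Hex) => n /asboolP[p [g [<- [a [a' [b [Ha Ha']]]]]]] Hmin.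
exists (reduce p), g; split; last 1 first.
- move=> p' g' Hp'; apply: leq_trans (size_reduce p) _.
  by apply: Hmin; apply/asboolP; exists p', g'.
- by exists a, a', b; rewrite eval_reduce.
exact: reduce_reduced.
Qed.

Variables (p : seq (letter k)) (g0 : free_group k).
Hypothesis Hp : bichrome p g0.
Hypothesis redp : reduced p.
Hypothesis minp : forall p' g', bichrome p' g' -> size p <= size p'.

Lemma minimal_contra p' g : bichrome p' g -> size p' < size p -> False.
Proof. by move=> /minp; rewrite leqNgt => /negP. Qed.

(** A shortest path is reduced together with the exits at its ends: if it ran
    through one of them, that exit could be replaced by the next edge. Hence
    [exit_connect] applies to it unless it is long. *)
Lemma bichrome_long : L <= (size p).+1.
Proof.
have [a [a' [b [Ha Ha']]]] := Hp; rewrite leqNgt; apply/negP => HL.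
suff Hr : reduced (letter_inv a :: rcons p a').
  have [Hw Hm] := Ha; have [_ Hm'] := Ha'.
  have := exit_connect HA Hc h_cyc h_all Hw Hm Hm' Hr HL.
  by case: (b).
have Hl : if p is d :: _ then d != a else a' != a.
  case: (p) Ha' (@minimal_contra) => [|d q] Ha' Hs.
    apply/eqP => aa; rewrite aa eval_nil mulg1 in Ha'.
    have [_ Hm] := Ha; have [_ Hm'] := Ha'.
    by have := ends_color_unique Hm Hm'; case: (b).
  apply/eqP => da; apply: (Hs q (g0 * elt a)) => //.
  exists a, a', b; split; last by rewrite -mulgA -eval_cons -da.
  exact: exit_color_step Ha (no_cancel_self a).
have Hr : reduced (rcons p a').
  case/lastP: (p) redp Ha' (@minimal_contra) => [|q d] // Hq Ha' Hs.
  rewrite reduced_rcons2 Hq /=; apply/eqP => da.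
  apply: (Hs q g0); last by rewrite size_rcons.
  exists a, a', b; split=> //.
  have := exit_color_step Ha' (no_cancel_self a').
  by rewrite eval_rcons da elt_inv mulgA mulgK.
by case: (p) Hl Hr => [|d q] /= Hl; rewrite /reduced /= ?andbT => ?; rewrite no_cancel_inv Hl.
Qed.

Definition inner j := g0 * eval (take j p).

(** An exit at an interior vertex would have one of the two colours, and could
    then replace one of the ends of the path. *)
Lemma inner_loops j l : 0 < j -> j < size p -> loops_from A (inner j) l.
Proof.
move=> j0 jp; apply: contrapT => Hw.
have [b' Hb'] := exit_ends_color HA Hc L_ge2 h_cyc h_all Hw.
have [a [a' [b [Ha Ha']]]] := Hp.
have [bb|bb] := eqVneq b' b.
  apply: (@minimal_contra (drop j p) (inner j)).
    exists l, a', b; split; first by rewrite -bb.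
    by rewrite -mulgA -eval_cat cat_take_drop.
  by rewrite size_drop ltn_subrL j0 (ltn_trans j0 jp).
apply: (@minimal_contra (take j p) g0); last by rewrite size_take jp.
exists a, l, b; split=> //; split=> //.
by have -> : ~~ b = b' by case: (b) b' bb {Hb'} => [] [].
Qed.

(** Otherwise the part between the two vertices could be cut out. *)
Lemma inner_inj i j : i < size p -> j < size p ->
  same_coset A (inner i) (inner j) -> i = j.
Proof.
wlog ij : i j / i <= j.
  move=> H Hi Hj Hs; case/orP: (leq_total i j) => Hij; first exact: H.
  by apply/esym/H => //; apply: same_sym.
move=> Hi Hj Hs; apply/eqP; rewrite eqn_leq ij leqNgt; apply/negP => lij.
apply: (@minimal_contra (take i p ++ drop j p) g0).
  have [a [a' [b [Ha Ha']]]] := Hp; exists a, a', b; split=> //.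
  apply: exit_color_same Ha'; rewrite -[p in eval p](cat_take_drop j) !eval_cat !mulgA.
  by apply/same_mulr; apply: same_sym.
rewrite size_cat size_drop size_takel; last exact: ltnW.
by rewrite -[X in _ < X](subnKC (ltnW Hj)) ltn_add2r.
Qed.

(** If all edges at the first vertex were exits, so would be the first edge of
    the path, and a shorter path would do. This shows that [A] is not trivial,
    which is the claim for L = 2. *)
Lemma bichrome_loops : exists l, loops_from A g0 l.
Proof.
have : 0 < size p by rewrite -ltnS; apply: leq_trans bichrome_long.
have [a [a' [b [Ha Ha']]]] := Hp.
case: (p) Ha' (@minimal_contra) => // d q Ha' Hs _; exists d; apply: contrapT => Hw.
have [b' Hb'] := exit_ends_color HA Hc L_ge2 h_cyc h_all Hw.
have [bb|bb] := eqVneq b' b.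
  apply: (Hs q (g0 * elt d)) => //; exists d, a', b; split; last by rewrite -mulgA -eval_cons.
  by apply: exit_color_step (no_cancel_self d); rewrite -bb.
apply: (Hs [::] g0) => //; exists a, d, b; split=> //; split; rewrite eval_nil mulg1 //.
by have -> : ~~ b = b' by case: (b) b' bb {Hb'} => [] [].
Qed.

End Separation.

(** * The rank bounds edges minus vertices *)

Section Representatives.

Variables (G : groupType) (A : G -> Prop).
Hypothesis HA : subgroup_pred A.

Lemma rep_ex (x : G) : exists y, `[< same_coset A x y >].
Proof. by exists x; apply/asboolP; apply: same_refl. Qed.

(** [xchoose] depends only on the extension of the predicate, so all elements of
    a coset get the same representative. *)
Definition rep x := xchoose (rep_ex x).

Lemma same_rep x : same_coset A x (rep x).
Proof. exact/asboolP/(xchooseP (rep_ex x)). Qed.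

Lemma rep_same x y : same_coset A x y <-> rep x = rep y.
Proof.
split=> [Hxy|Hxy].
  apply: eq_xchoose => z; apply/asboolP/asboolP; last exact: same_trans.
  exact: (same_trans HA (same_sym HA Hxy)).
apply: (same_trans HA (same_rep x)); rewrite Hxy.
by apply: same_sym => //; apply: same_rep.
Qed.

Lemma repK x : rep (rep x) = rep x.
Proof. by apply/esym/rep_same; apply: same_rep. Qed.

Lemma rep_mulr x z : rep (rep x * z) = rep (x * z).
Proof. by apply/esym/rep_same/same_mulr; apply: same_rep. Qed.

End Representatives.

Section Cochains.

Variables (k r : nat) (A : free_group k -> Prop) (gens : 'I_r -> free_group k).
Hypothesis HA : subgroup_pred A.
Hypothesis Hgens : generated_by gens A.
Implicit Types (a l : letter k) (u v w : seq (letter k)) (g x y t : free_group k).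

Section Integration.

Variable val : free_group k -> letter k -> bool.
Hypothesis val_same : forall g g' l, same_coset A g g' -> val g l = val g' l.
Hypothesis val_sym : forall g l, val (g * elt l) (letter_inv l) = val g l.

(** The integral of the mod 2 cochain [val] along the path that reads [w] from
    [g]. No signs are needed as the coefficients are in Z/2. *)
Fixpoint integral g w : bool :=
  if w is l :: w' then val g l (+) integral (g * elt l) w' else false.

Lemma integral_cat g u v :
  integral g (u ++ v) = integral g u (+) integral (g * eval u) v.
Proof.
elim: u g => [|l u IH] g /=; first by rewrite eval_nil mulg1.
by rewrite IH (eval_cons l) mulgA addbA.
Qed.

Lemma integral_same g g' w : same_coset A g g' -> integral g w = integral g' w.
Proof.
elim: w g g' => //= l w IH g g' Hg; congr addb; first exact: val_same.
by apply: IH; apply/same_mulr.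
Qed.

Lemma integral_reduce g w : integral g (reduce w) = integral g w.
Proof.
elim: w g => //= l w IH g; rewrite -IH.
case: (reduce w) => [|b v] //=; case: eqP => [->|_] //=.
by rewrite val_sym elt_inv mulgK addbA addbb.
Qed.

Definition primitive x := integral 1 (word x).

Lemma primitiveM x y : primitive (x * y) = primitive x (+) integral x (word y).
Proof. by rewrite /primitive integral_reduce integral_cat eval_word mul1g. Qed.

Lemma primitive_edge x l : primitive (x * elt l) = primitive x (+) val x l.
Proof. by rewrite primitiveM /= addbF. Qed.

Hypothesis prim_gen : forall i, primitive (gens i) = false.

Lemma primitive_sub x : A x -> primitive x = false.
Proof.
have sub y z : A y -> integral y (word z) = primitive z.
  by move=> Ay; apply: integral_same; rewrite /same_coset divg1.
move=> Ax; suff [] : A x /\ primitive x = false by [].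
case: Hgens => HgA /(_ (fun x => A x /\ primitive x = false)); apply=> //.
split=> [|y z [Ay Hy] [Az Hz]|y [Ay Hy]].
- by split; first exact: subgroup1.
- by split; [exact: subgroupM|rewrite primitiveM sub // Hy Hz].
have AyV : A y^-1 by apply: subgroupV.
split=> //; have := primitiveM y^-1 y.
by rewrite mulVg sub // Hy addbF => <-.
Qed.

(** A cochain whose integral vanishes on the generators of [A] is the coboundary
    of a function on the vertices of the coset graph. *)
Lemma primitive_same x y : same_coset A x y -> primitive x = primitive y.
Proof.
move=> Hxy; rewrite -[x](mulgVK y) primitiveM primitive_sub //=.
by apply: integral_same; rewrite /same_coset divg1.
Qed.

End Integration.

Lemma integral_addb f1 f2 g w :
  integral (fun x l => f1 x l (+) f2 x l) g w = integral f1 g w (+) integral f2 g w.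
Proof. by elim: w g => //= l w IH g; rewrite IH addbACA. Qed.

(** A cochain supported on [E] is determined by its integrals along the
    generators and by the differences between the values of its primitive on
    [V], whence 2 ^ |E| <= 2 ^ r * 2 ^ (|V| - 1). *)
Lemma edges_le_rank (E : seq (free_group k * letter k)) (V : seq (free_group k)) :
  uniq E -> 0 < size V ->
  (forall x l, (x, l) \in E ->
     [/\ l.2, rep HA x = x, x \in V & rep HA (x * elt l) \in V]) ->
  size E < r + size V.
Proof.
move=> uE V0 HE; set n := size E.
pose pos (f : n.-tuple bool) g i := nth false f (index (rep HA g, (i, true)) E).
(* The cochain of [f] is read off from the positively oriented edges. *)
pose val f g (l : letter k) := if l.2 then pos f g l.1 else pos f (g * elt l) l.1.
have val_same f g g' l : same_coset A g g' -> val f g l = val f g' l.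
  move=> Hg; have Hgl : same_coset A (g * elt l) (g' * elt l) by apply/same_mulr.
  by rewrite /val /pos (proj1 (rep_same HA _ _) Hg) (proj1 (rep_same HA _ _) Hgl).
have val_sym f g l : val f (g * elt l) (letter_inv l) = val f g l.
  by rewrite /val elt_inv mulgK; case: l => i [].
pose v0 := nth 1 V 0.
pose F f := ([ffun i => primitive (val f) (gens i)],
  [ffun j : 'I_(size V).-1 =>
     primitive (val f) (nth 1 V j.+1) (+) primitive (val f) v0]).
(* The integrals along the generators, and the differences of the primitive on
   [V] to its value at one vertex [v0]. *)
suff /leq_card : injective F.
  rewrite card_tuple card_prod !card_ffun !card_ord card_bool -expnD leq_exp2l //.
  by rewrite -ltnS -addnS prednK.
move=> f f' [/ffunP Hgen /ffunP HV].
pose d g l := val f g l (+) val f' g l.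
have d_same g g' l : same_coset A g g' -> d g l = d g' l.
  by move=> Hg; rewrite /d !(val_same _ _ _ _ Hg).
have d_sym g l : d (g * elt l) (letter_inv l) = d g l by rewrite /d !val_sym.
have dE x : primitive d x = primitive (val f) x (+) primitive (val f') x.
  exact: integral_addb.
have d_gen i : primitive d (gens i) = false.
  by have := Hgen i; rewrite !ffunE dE => ->; rewrite addbb.
have dV x : x \in V -> primitive d x = primitive d v0.
  move=> /(nthP 1)[[|j] Hj <-] //; have Hj' : j < (size V).-1 by rewrite -ltnS prednK.
  have := HV (Ordinal Hj'); rewrite !ffunE !dE /=.
  by do 4!case: primitive.
have d0 x l : (x, l) \in E -> d x l = false.
  move=> /HE[_ _ xV yV]; have := primitive_edge d_sym x l.
  rewrite (primitive_same d_same d_sym d_gen (same_rep HA (x * elt l))) !dV //.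
  by case: primitive; case: (d x l).
apply: eq_from_tnth => j; rewrite !(tnth_nth false).
have [x0 ] : exists x0 : free_group k * letter k, True.
  by case: (n) j (E) (erefl : n = size E) => [[]|m _ [|e ?]] // _; exists e.
move=> _; have Hj := ltn_ord j; have := mem_nth x0 Hj.
case Ej: (nth x0 E j) => [x l] xE; have := d0 _ _ xE; have [l2 Hx _ _] := HE _ _ xE.
rewrite /d /val l2 /pos Hx.
have -> : (x, (l.1, true)) = (x, l) by case: l l2 {Ej xE} => i [].
by rewrite -Ej index_uniq //; do 2!case: nth.
Qed.

End Cochains.

(** * A finite subgraph with many vertices of full valence *)

Section CoreSubgraph.

Variables (k r : nat) (A : free_group k -> Prop) (gens : 'I_r -> free_group k).
Hypothesis HA : subgroup_pred A.
Hypothesis Hgens : generated_by gens A.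
Implicit Types (a l : letter k) (u w : seq (letter k)) (g v x y t : free_group k).
Implicit Types (O : seq (free_group k * letter k)) (S : seq (free_group k)).

Definition edge_inv (e : free_group k * letter k) :=
  (rep HA (e.1 * elt e.2), letter_inv e.2).

(** Vertices are recorded by canonical representatives, and every edge occurs in
    both orientations. *)
Definition edge_set O := forall x l, (x, l) \in O ->
  rep HA x = x /\ edge_inv (x, l) \in O.

(** For an edge [(x, l)] of [O], this says that [x] has valence at least 2. *)
Definition has_turn O x l := exists l', l' != l /\ (x, l') \in O.

Fixpoint trace g w : seq (free_group k * letter k) :=
  if w is l :: w' then
    (rep HA g, l) :: (rep HA (g * elt l), letter_inv l) :: trace (g * elt l) w'
  else [::].

Lemma trace_edges g w : edge_set (trace g w).
Proof.
elim: w g => //= a w IH g x l; rewrite !inE => /or3P[/eqP[-> ->]|/eqP[-> ->]|/IH[-> H]].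
- by rewrite repK /edge_inv /= rep_mulr eqxx orbT.
- by rewrite repK /edge_inv /= rep_mulr elt_inv mulgK letter_invK eqxx.
by rewrite H !orbT.
Qed.

(** At an interior vertex of a reduced path, the edge by which the path leaves
    and the reversed edge by which it arrives are different. *)
Lemma trace_turn g w x l : reduced w -> (x, l) \in trace g w ->
  [\/ x = rep HA g, x = rep HA (g * eval w) | has_turn (trace g w) x l].
Proof.
elim: w g => //= a w IH g Hw; rewrite !inE.
have in_sub e : e \in trace (g * elt a) w -> e \in trace g (a :: w).
  by rewrite /= !inE => ->; rewrite !orbT.
case: w Hw IH in_sub => [|b w] Hw IH in_sub.
  by case/or3P=> // /eqP[-> _]; [constructor 1|constructor 2].
move: Hw; rewrite /reduced /= => /andP[Hab Hw].
have Ha : (rep HA (g * elt a), letter_inv a) \in trace g [:: a, b & w].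
  by rewrite /= !inE eqxx !orbT.
have Hb : (rep HA (g * elt a), b) \in trace g [:: a, b & w].
  by rewrite /= !inE eqxx !orbT.
case/or3P=> [/eqP[-> _]|/eqP[-> ->]|/(IH _ Hw)[->|->|[l' [Hl' Hin]]]].
- by constructor 1.
- by constructor 3; exists b.
- constructor 3; have [->|lb] := eqVneq l b; last by exists b; rewrite eq_sym.
  by exists (letter_inv a); rewrite eq_sym.
- by constructor 2; rewrite -mulgA -eval_cons.
by constructor 3; exists l'; split=> //; apply: in_sub.
Qed.

(** The union of one loop for each vertex of [S] and each letter. Only the base
    point of a loop may have valence 1 in that loop, and it lies in [S]. *)
Lemma core_exists S : (forall v, v \in S -> forall l, loops_from A v l) ->
  exists O, [/\ edge_set O,
    forall x l, (x, l) \in O -> x \in [seq rep HA v | v <- S] \/ has_turn O x l &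
    forall v l, v \in S -> (rep HA v, l) \in O].
Proof.
move=> HS.
suff H (Q : seq (free_group k * letter k)) : {subset [seq q.1 | q <- Q] <= S} ->
  exists O, [/\ edge_set O,
    forall x l, (x, l) \in O -> x \in [seq rep HA v | v <- S] \/ has_turn O x l &
    forall q, q \in Q -> (rep HA q.1, q.2) \in O].
  have [|O [O1 O2 O3]] := H [seq (v, l) | v <- S, l <- enum {: letter k}].
    by move=> _ /mapP[[v l] /allpairsP[[v' l'] /= [vS _ [-> _]]] ->].
  exists O; split=> // v l vS; apply: (O3 (v, l)).
  by apply/allpairsP; exists (v, l); rewrite /= mem_enum.
elim: Q => [|[v l] Q IH] HQ; first by exists [::]; split.
have [|O [O1 O2 O3]] := IH; first by move=> x xQ; apply: HQ; rewrite /= inE xQ orbT.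
have vS : v \in S by apply: HQ; rewrite /= mem_head.
have [u [Hu Hvu]] := HS v vS l.
pose O' := trace v (l :: u) ++ O; exists O'; split.
- move=> x a; rewrite /O' !mem_cat => /orP[Hx|/O1[-> ->]]; last by rewrite orbT.
  by have [-> ->] := trace_edges Hx.
- have sub1 : {subset trace v (l :: u) <= O'} by move=> e He; rewrite mem_cat He.
  have sub2 : {subset O <= O'} by move=> e He; rewrite mem_cat He orbT.
  have turn O1' x a : {subset O1' <= O'} -> has_turn O1' x a -> has_turn O' x a.
    by move=> sub [a' [Ha' Hin]]; exists a'; split=> //; apply: sub.
  have vS' : rep HA v \in [seq rep HA v | v <- S] by apply: map_f.
  move=> x a; rewrite mem_cat => /orP[/(trace_turn Hu)[->|->|Ht]|/O2[|Ht]].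
  + by left.
  + by left; rewrite (proj1 (rep_same HA _ _) Hvu).
  + by right; apply: turn Ht.
  + by left.
  by right; apply: turn Ht.
move=> q; rewrite inE => /orP[/eqP->|/O3 H]; first by rewrite /O' /= mem_head.
by rewrite /O' mem_cat H orbT.
Qed.

Lemma card_letter : #|{: letter k}| = k.*2.
Proof. by rewrite card_prod card_ord card_bool muln2. Qed.

(** Reversal maps the negatively oriented edges injectively to the positively
    oriented ones. *)
Lemma handshake O : uniq O -> edge_set O ->
  size O <= (count (fun e => e.2.2) O).*2.
Proof.
move=> uO HO; rewrite -(count_predC (fun e => e.2.2) O) -addnn leq_add2l.
have inj : {in O &, injective edge_inv}.
  move=> [x l] [y l'] /HO[rx _] /HO[ry _] Exy.
  have Hl : l = l' := can_inj (@letter_invK k) (congr1 snd Exy).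
  have /= Hxy := congr1 fst Exy.
  rewrite -Hl in Hxy *; congr pair; rewrite -rx -ry; apply/rep_same.
  by apply/(same_mulr A (elt l))/(rep_same HA).
rewrite -!size_filter -(size_map edge_inv); apply: uniq_leq_size.
  rewrite map_inj_in_uniq ?filter_uniq // => x y; rewrite !mem_filter.
  by move=> /andP[_ xO] /andP[_ yO]; apply: inj.
move=> e /mapP[[x l]]; rewrite mem_filter => /andP[/= Hl /HO[_ HxO]] ->.
by rewrite mem_filter HxO andbT.
Qed.

(** In the graph of [core_exists] the sum of the valences is at least
    2 |V| + (2k - 2) |S|, and it is at most 2 |E|; [edges_le_rank] bounds
    |E| - |V|. *)
Lemma full_vertices_le_rank S : 0 < k -> 0 < size S ->
  (forall v, v \in S -> forall l, loops_from A v l) -> uniq [seq rep HA v | v <- S] ->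
  (k - 1) * size S < r.
Proof.
move=> k0 S0 HS; set S' := map _ S => uS.
have [O0 [O1 O2 O3]] := core_exists HS.
pose O := undup O0; pose V := undup [seq e.1 | e <- O].
have uO : uniq O by apply: undup_uniq.
have HO : edge_set O by move=> x l; rewrite !mem_undup; apply: O1.
have memV x l : (x, l) \in O -> x \in V.
  by move=> xO; rewrite mem_undup; apply/mapP; exists (x, l).
have S'O x l : x \in S' -> (x, l) \in O.
  by case/mapP=> v vS ->; rewrite mem_undup O3.
pose l0 : letter k := (Ordinal k0, true).
have S'V : {subset S' <= V} by move=> x /(S'O _ l0) /memV.
pose deg x := size [seq l <- enum {: letter k} | (x, l) \in O].
have deg_S x : x \in S' -> deg x = k.*2.
  move=> xS; rewrite /deg -card_letter cardE; congr size; apply/all_filterP/allP => l _.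
  exact: S'O.
have deg_ge2 x : x \in V -> 2 <= deg x.
  rewrite mem_undup => /mapP[[y l] yO /= ->].
  have : (y, l) \in O0 by rewrite -mem_undup.
  case/O2=> [yS|[l' [Hl' Hin]]]; first by rewrite deg_S // (leq_double 1).
  apply: (@uniq_leq_size _ [:: l; l']); first by rewrite /= inE eq_sym Hl'.
  move=> a; rewrite !inE mem_filter mem_enum andbT => /orP[/eqP->|/eqP->] //.
  by rewrite mem_undup.
have sumO : \sum_(x <- V) deg x <= size O.
  have -> : \sum_(x <- V) deg x =
      size [seq (x, l) | x <- V, l <- [seq l <- enum {: letter k} | (x, l) \in O]].
    by rewrite size_allpairs_dep sumnE big_map.
  apply: uniq_leq_size.
    apply: allpairs_uniq_dep; first exact: undup_uniq.
      by move=> x _; rewrite filter_uniq ?enum_uniq.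
    by move=> [x l] [y l'] _ _ /= [-> ->].
  move=> _ /allpairsPdep[x [l [_ Hl ->]]].
  by move: Hl; rewrite mem_filter => /andP[].
have sumV : (size V).*2 + (k.-1).*2 * size S <= \sum_(x <- V) deg x.
  apply: (@leq_trans (\sum_(x <- V) (2 + (x \in S') * (k.-1).*2))).
    rewrite big_split /= big_const_seq count_predT iter_addn_0 mul2n leq_add2l.
    rewrite -big_distrl /= mulnC leq_mul2r; apply/orP; right.
    rewrite -(size_map (rep HA) S) -/S'.
    have -> : \sum_(x <- V) (x \in S' : nat) = size [seq x <- V | x \in S'].
      by rewrite size_filter -sum1_count [RHS]big_mkcond; apply: eq_bigr => x _; case: ifP.
    by apply: uniq_leq_size => // x xS; rewrite mem_filter xS S'V.
  rewrite big_seq [X in _ <= X]big_seq; apply: leq_sum => x xV.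
  case: (boolP (x \in S')) => [/deg_S ->|_]; last by rewrite mul0n addn0 deg_ge2.
  by rewrite mul1n -[in X in _ <= X](prednK k0) doubleS.
have := @edges_le_rank k r A gens HA Hgens [seq e <- O | e.2.2] V.
have -> : size [seq e <- O | e.2.2] = count (fun e => e.2.2) O by rewrite size_filter.
move=> H; have {H} : count (fun e => e.2.2) O < r + size V.
  apply: H; first exact: filter_uniq.
    by apply: leq_trans (uniq_leq_size uS S'V); rewrite size_map.
  move=> x l; rewrite mem_filter => /andP[Hl xlO]; have [rx Hinv] := HO x l xlO.
  by split=> //; apply: memV; eassumption.
rewrite -ltn_double => Hlt.
have := leq_ltn_trans (leq_trans (leq_trans sumV sumO) (handshake uO HO)) Hlt.
by rewrite doubleD addnC ltn_add2r -doubleMl ltn_double subn1.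
Qed.

End CoreSubgraph.

(** * Half-trees *)

Section Walks.

Variables (V : Type) (e : V -> V -> Prop).
Implicit Types (x y : V) (p q : seq V).

Lemma walk_cat x p q : walk e x (p ++ q) <-> walk e x p /\ walk e (last x p) q.
Proof. by elim: p x => [|y p IH] x /=; rewrite ?IH; tauto. Qed.

Lemma walk_sub (e' : V -> V -> Prop) x p :
  (forall y z, e y z -> e' y z) -> walk e x p -> walk e' x p.
Proof. by move=> H; elim: p x => //= y p IH x [/H Hxy /IH]. Qed.

(** Circuits are cut out of the walk one after the other. *)
Lemma walk_nodup x p : walk e x p ->
  exists q, [/\ List.NoDup (x :: q), walk e x q & last x q = last x p].
Proof.
elim: p x => [|y p IH] x /=.
  by move=> _; exists [::]; split=> //; constructor=> //; constructor.
move=> [Hxy /IH[q [Hq Hw <-]]].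
have [Hin|Hout] := pselect (List.In x (y :: q)); last first.
  by exists (y :: q); split=> //; constructor.
have [q1 [q2 Hq12]] := List.in_split _ _ Hin.
exists q2; split.
- by move: Hq; rewrite Hq12 => /List.NoDup_app_remove_l.
- have : walk e x (y :: q) by [].
  by rewrite Hq12 => /walk_cat[_ []].
by have -> : last y q = last x (y :: q) by []; rewrite Hq12 last_cat.
Qed.

End Walks.

Section HalfTrees.

Variable T : tree.
Implicit Types (s t x y z : T) (p q : seq T).

(** The half-tree at the end [z] of the edge [y -- z]. *)
Definition half y z t : Prop :=
  exists p, walk (fun a b => adj a b /\ b <> y) z p /\ last z p = t.

Lemma half_start y z : half y z z.
Proof. by exists [::]. Qed.

Lemma half_step y z t t' : half y z t -> adj t t' -> t' <> y -> half y z t'.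
Proof.
move=> [p [Hp <-]] Ht Hy; exists (p ++ [:: t']); rewrite last_cat; split=> //.
by apply/walk_cat.
Qed.

Lemma half_induction y z (P : T -> Prop) : P z ->
  (forall t t', half y z t -> P t -> adj t t' -> t' <> y -> P t') ->
  forall t, half y z t -> P t.
Proof.
move=> Pz Hstep t [p [Hp <-]].
suff H x : half y z x -> P x -> walk (fun a b => adj a b /\ b <> y) x p ->
    P (last x p) by apply: H (half_start y z) Pz Hp.
elim: p x {Hp} => //= w p IH x Hx Px [[Hxw Hwy] Hp].
by apply: IH => //; [apply: half_step Hx _ _|apply: Hstep Px _ _].
Qed.

Lemma adj_neq y z : adj y z -> z <> y.
Proof. by move=> Hyz E; apply: (@adj_irrefl T y); rewrite -{2}E. Qed.

Lemma half_avoid y z t : adj y z -> half y z t -> t <> y.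
Proof. by move=> /adj_neq Hyz; apply: (half_induction (P := fun s => s <> y)). Qed.

(** Acyclicity: a simple walk from [z] to [t] that avoids [y] would close up to
    a circuit through [y]. *)
Lemma half_cross y z t : adj y z -> half y z t -> adj t y -> t = z.
Proof.
move=> Hyz [p [Hp <-]]; have [q [Hnd Hq <-]] := walk_nodup Hp => Hlast {Hp}.
have avoid x r : walk (fun a b => adj a b /\ b <> y) x r -> ~ List.In y r.
  elim: r x => [|w r IH] x /=; first by move=> _ [].
  by move=> [[_ Hwy] Hr] [wy|]; [apply: Hwy | apply: IH Hr].
have Hyq : ~ List.In y (z :: q).
  by move=> [zy|]; [apply: adj_neq zy | apply: avoid Hq].
have /= := @tree_acyclic T y (z :: q).
case: q Hnd Hq Hlast Hyq => [|w q] // Hnd Hq Hlast Hyq.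
have H1 : List.NoDup [:: y, z, w & q] by constructor.
move/(_ H1) => H; suff : 1 < 1 by []; apply: (leq_trans _ (H _ _)) => //.
by split=> //; apply: walk_sub Hq => a b [].
Qed.

Lemma half_exit y z t t' : adj y z -> half y z t -> adj t t' ->
  ~ half y z t' -> t = z /\ t' = y.
Proof.
move=> Hyz Ht Htt' Ht'.
have E : t' = y by apply: contrapT => E; apply: Ht'; apply: half_step Ht Htt' E.
by split=> //; apply: half_cross Ht _ => //; rewrite -E.
Qed.

Lemma walk_enter y z x p : adj y z -> walk (@adj T) x p ->
  ~ half y z x -> half y z (last x p) ->
  exists p1 p2, p = p1 ++ z :: p2 /\ last x p1 = y.
Proof.
move=> Hyz; elim: p x => [|w p IH] x //= [Hxw Hp] Hx Hlast.
have [Hw|Hw] := pselect (half y z w).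
  have [-> ->] := half_exit Hyz Hw (adj_sym Hxw) Hx.
  by exists [::], p.
by have [p1 [p2 [-> <-]]] := IH w Hp Hw Hlast; exists (w :: p1), p2.
Qed.

Lemma walk_leave y z x p : adj y z -> walk (@adj T) x p ->
  half y z x -> ~ half y z (last x p) -> List.In y p.
Proof.
move=> Hyz; elim: p x => [|w p IH] x //= [Hxw Hp] Hx Hlast.
have [Hw|Hw] := pselect (half y z w); first by right; apply: IH Hlast.
by left; have [] := half_exit Hyz Hx Hxw Hw.
Qed.

(** The complement of a half-tree is convex: a simple path that enters the
    half-tree must pass through [y] again to leave it. *)
Lemma outside_convex y z x p : adj y z -> List.NoDup (x :: p) ->
  walk (@adj T) x p -> ~ half y z x -> ~ half y z (last x p) ->
  forall s, List.In s (x :: p) -> ~ half y z s.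
Proof.
move=> Hyz; elim: p x => [|w p IH] x Hnd /=; first by move=> _ Hx _ s [<-|].
move=> [Hxw Hp] Hx Hlast s [<- //|].
have [Hw|Hw] := pselect (half y z w); last first.
  by apply: IH => //; inversion Hnd.
have [_ Exy] := half_exit Hyz Hw (adj_sym Hxw) Hx.
have := walk_leave Hyz Hp Hw Hlast; rewrite -Exy => Hin.
by inversion Hnd as [|? ? Hnot]; case: Hnot; right.
Qed.

Lemma half_disjoint y z t : adj y z -> half z y t -> ~ half y z t.
Proof.
move=> Hyz; apply: (half_induction (P := fun s => ~ half y z s)).
  by move=> /(half_avoid Hyz).
move=> s s' _ Hs Hss' Hs'z Hs'.
by have [] := half_exit Hyz Hs' (adj_sym Hss') Hs.
Qed.

Lemma half_nested y z z' t : adj y z -> adj z z' -> z' <> y ->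
  half z z' t -> half y z t.
Proof.
move=> Hyz Hzz' Hz'; apply: (half_induction (P := half y z)).
  exact: half_step (half_start y z) Hzz' Hz'.
move=> s s' Hsz Hs Hss' Hs'z; apply: (half_step Hs Hss') => E.
apply: (half_avoid Hzz' Hsz); apply: (half_cross Hyz Hs).
by rewrite -E.
Qed.

End HalfTrees.

(** * Minimal actions on trees *)

Section Action.

Variables (G : groupType) (T : splitting G).
Implicit Types (s t u v x y z : T) (p q : seq T) (g : G).

Lemma actK g x : act g^-1 (act g x) = x :> T.
Proof. by rewrite -actM mulVg act1. Qed.

Lemma actVK g x : act g (act g^-1 x) = x :> T.
Proof. by rewrite -actM mulgV act1. Qed.

Lemma walk_act g x p : walk (@adj T) x p -> walk (@adj T) (act g x) (map (act g) p).
Proof. by elim: p x => //= y p IH x [/(act_adj g) Hxy /IH]. Qed.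

Lemma half_act g y z t : half y z t -> half (act g y) (act g z) (act g t).
Proof.
apply: (half_induction (P := fun s => half (act g y) (act g z) (act g s))).
  exact: half_start.
move=> s s' _ Hs Hss' Hs'; apply: half_step Hs (act_adj g Hss') _.
by move=> E; apply: Hs'; rewrite -(actK g s') E actK.
Qed.

(** The points whose orbit misses the half-tree form an invariant set, which is
    convex as an intersection of complements of half-trees. If it contained
    [x0], it would be the whole tree by minimality. *)
Lemma half_orbit y z x0 : adj y z -> exists g, half y z (act g x0 : T).
Proof.
move=> Hyz; apply: contrapT => Hno.
pose S (t : T) := forall g, ~ half y z (act g t).
suff /(_ z 1) : forall t, S t by rewrite act1; apply; apply: half_start.
apply: act_minimal; last by move=> g t Ht g'; rewrite -actM; apply: Ht.
split; first by exists x0 => g Hg; apply: Hno; exists g.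
move=> s t Hs Ht.
have [p [Hp Elast]] := @tree_connected T s t I I.
have {}Hp : walk (@adj T) s p by apply: walk_sub Hp => a b [].
have [q [Hnd Hq]] := walk_nodup Hp; rewrite Elast => {Hp p}Elast.
have HS r : List.In r (s :: q) -> S r.
  move=> Hr g Hg.
  have Hyz' : adj (act g^-1 y : T) (act g^-1 z) by apply: act_adj.
  have out r' : S r' -> ~ half (act g^-1 y) (act g^-1 z) r'.
    by move=> Hr' /(half_act g); rewrite !actVK; apply: Hr'.
  have := outside_convex Hyz' Hnd Hq (out _ Hs); rewrite Elast => /(_ (out _ Ht) _ Hr).
  by apply; rewrite -[X in half _ _ X](actK g); apply: half_act.
exists q; split=> //; move: HS Hq {Hnd Elast Hs Ht}.
elim: q s => //= w q IH s HS [Hsw Hq]; split.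
  by split=> //; split; apply: HS; [left|right; left].
by apply: IH => // r Hr; apply: HS; right.
Qed.

(** If [z] were a leaf, the half-tree at [z] would consist of [z] alone and
    contain a point [g y]. Then [y] would also be a leaf and [g] would invert
    the edge. *)
Lemma no_leaf y z : adj y z -> exists2 z' : T, adj z z' & z' <> y.
Proof.
move=> Hyz; apply: contrapT => Hleaf.
have only w : adj z w -> w = y.
  by move=> Hzw; apply: contrapT => Hw; apply: Hleaf; exists w.
have [g [[|w p] /=]] := half_orbit y Hyz; last by move=> [[[/only Hw Hwy]]].
move=> [_ Egy]; apply: (@act_no_inversion _ T g y z Hyz); split=> //.
by apply: only; have := act_adj g Hyz; rewrite -Egy.
Qed.

(** As there are no leaves, one can move away from the edge step by step. *)
Lemma half_deep n u v : adj u v -> exists y z : T, [/\ adj y z,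
  forall t, half y z t -> half u v t &
  forall p, walk (@adj T) u p -> half y z (last u p) -> n < size p].
Proof.
move=> Huv; elim: n => [|n [y [z [Hyz Hsub Hlen]]]].
  by exists u, v; split=> // -[|w p] //= _ /(half_avoid Huv).
have [z' Hzz' Hz'] := no_leaf Hyz; exists z, z'; split=> //.
  by move=> t /(half_nested Hyz Hzz' Hz')/Hsub.
move=> p Hp Hlast; have Hu : ~ half z z' u.
  by move/(half_nested Hyz Hzz' Hz')/Hsub/(half_avoid Huv).
have [p1 [p2 [Ep Ez]]] := walk_enter Hzz' Hp Hu Hlast.
move: Hp; rewrite Ep => /walk_cat[Hp1 _].
have := Hlen p1 Hp1; rewrite Ez => /(_ (half_start y z)) Hn.
by rewrite size_cat /= addnS ltnS; apply: leq_trans Hn (leq_addr _ _).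
Qed.

End Action.

(** * The colouring defined by an edge *)

Section EdgeColoring.

Variables (k : nat) (T : splitting (free_group k)) (A : free_group k -> Prop).
Variables (u v : T).
Hypothesis Huv : adj u v.
Hypothesis HAuv : forall g, A g <-> act g u = u /\ act g v = v.
Implicit Types (s t x y z : T) (p q : seq T) (g : free_group k).

Lemma edge_stab_subgroup : subgroup_pred A.
Proof.
split=> [|g g' /HAuv[gu gv] /HAuv[gu' gv']|g /HAuv[gu gv]]; apply/HAuv.
- by rewrite !act1.
- by rewrite !actM gu' gv' gu gv.
by split; [rewrite -{1}gu actK | rewrite -{1}gv actK].
Qed.

(** The edge is crossed by the image under [g] of a fixed walk from [y] to [z].
    For each step of this walk, the elements that move it to the edge with a
    given orientation form at most one coset of [A]. *)
Lemma separating_cosets y z : exists D : seq (free_group k), forall g,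
  ~ (half u v (act g y) <-> half u v (act g z)) -> exists2 d, d \in D & same_coset A g d.
Proof.
have [p [Hp <-]] := @tree_connected T y z I I.
have {Hp}: walk (@adj T) y p by apply: walk_sub Hp => a b [].
elim: p y => [|w p IH] y /=; first by move=> _; exists [::] => g /(_ (iff_refl _)).
have coset s t : exists D : seq (free_group k), forall g,
    act g s = u /\ act g t = v -> exists2 d, d \in D & same_coset A g d.
  have [[d [ds dt]]|Hno] := pselect (exists d, act d s = u /\ act d t = v); last first.
    by exists [::] => g Hg; case: Hno; exists g.
  exists [:: d] => g [gs gt]; exists d; rewrite ?mem_head //.
  by apply/HAuv; rewrite !actM -{1}ds -{1}dt !actK.
move=> [Hyw /IH[D HD]]; have [D1 HD1] := coset y w; have [D2 HD2] := coset w y.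
exists (D1 ++ D2 ++ D) => g Hg.
have Hgyw := act_adj g Hyw.
have [Hy|Hy] := pselect (half u v (act g y));
have [Hw|Hw] := pselect (half u v (act g w)).
- have [d dD Hd] : exists2 d, d \in D & same_coset A g d.
    by apply: HD => E; apply: Hg; rewrite -E; split.
  by exists d; rewrite ?mem_cat ?dD ?orbT.
- have [E1 E2] := half_exit Huv Hy Hgyw Hw.
  have [d dD Hd] := HD2 g (conj E2 E1).
  by exists d; rewrite ?mem_cat ?dD ?orbT.
- have [E1 E2] := half_exit Huv Hw (adj_sym Hgyw) Hy.
  have [d dD Hd] := HD1 g (conj E2 E1).
  by exists d; rewrite ?mem_cat ?dD ?orbT.
have [d dD Hd] : exists2 d, d \in D & same_coset A g d.
  by apply: HD => E; apply: Hg; rewrite -E; split.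
by exists d; rewrite ?mem_cat ?dD ?orbT.
Qed.

(** The distance from [a] to [act g x0] depends only on the coset of [g], so it
    is bounded on finitely many cosets, but not on the points of the orbit in
    the half-tree. *)
Lemma far_orbit (a b : T) x0 (D : seq (free_group k)) :
  adj a b -> (forall g, A g -> act g a = a) ->
  exists2 g, half a b (act g x0) & forall d, d \in D -> ~ same_coset A g d.
Proof.
move=> Hab HAa.
have [|N HN] := @seq_bound _ D (fun d n => exists2 p : seq T,
    walk (@adj T) a p /\ last a p = act d x0 & size p <= n).
  move=> d; have [p [Hp Elast]] := @tree_connected T a (act d x0) I I.
  by exists (size p) => n Hn; exists p => //; split=> //; apply: walk_sub Hp => ? ? [].
have [y [z [Hyz Hsub Hlen]]] := half_deep N Hab.
have [g Hg] := half_orbit x0 Hyz; exists g; first exact: Hsub.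
move=> d dD Hd; have [p [Hp Elast] Hsize] := HN N d dD (leqnn N).
have Hp' := walk_act (g / d) Hp; rewrite HAa // in Hp'.
have : N < size (map (act (g / d)) p).
  apply: Hlen => //; rewrite -[X in last X _](HAa (g / d)) // last_map Elast.
  by rewrite -actM mulgVK.
by rewrite size_map ltnNge Hsize.
Qed.

Definition edge_color x0 g : bool := `[< half u v (act g x0) >].

Lemma edge_colorP (h : free_group k) (x0 w : T) : act h w = w ->
  elliptic_coloring A h (edge_color x0).
Proof.
move=> hw; have color_neq a b : `[< half u v a >] != `[< half u v b >] ->
    ~ (half u v a <-> half u v b).
  by move=> /eqP H E; apply: H; apply/asboolP/asboolP; tauto.
split.
- move=> x y Hxy; have /HAuv[gu gv] := Hxy.
  have half_shift g : A g -> forall t, half u v t -> half u v (act g t).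
    by move=> /HAuv[gu' gv'] t /(half_act g); rewrite gu' gv'.
  apply/asboolP/asboolP => [/(half_shift (y / x))|/(half_shift _ Hxy)].
    by rewrite -actM mulgVK; apply; apply: (same_sym edge_stab_subgroup).
  by rewrite -actM mulgVK.
- move=> y; have [D HD] := separating_cosets x0 (act y x0).
  by exists D => g; rewrite /edge_color actM => /color_neq; apply: HD.
- move=> s x; have [D HD] := separating_cosets (act x x0) (act s w).
  exists `[< half u v (act s w) >], D => n g Hg.
  rewrite /edge_color actM => Hne; apply: HD.
  have fixw : act (s * h / s) (act s w) = act s w.
    by rewrite -!actM mulgVK actM hw.
  have fixn m : act ((s * h / s) ^+ m) (act s w) = act s w.
    by elim: m => [|m IH]; rewrite ?expg0 ?act1 // expgS actM IH fixw.
  have -> : act g (act s w) = act s w.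
    by case: Hg => ->; rewrite ?fixn // -[in LHS](fixn n) actK.
  exact: color_neq.
move=> b D; have Hu g : A g -> act g u = u by move=> /HAuv[].
have Hv g : A g -> act g v = v by move=> /HAuv[].
case: b.
  have [g Hg HgD] := far_orbit x0 D Huv Hu; exists g => //; exact/asboolP.
have [g Hg HgD] := far_orbit x0 D (adj_sym Huv) Hv; exists g => //.
by apply/asboolPn/half_disjoint.
Qed.

End EdgeColoring.

(** * The lower bound on the rank *)

Lemma isomorphic_generated (r : nat) (G : groupType) (A : G -> Prop) :
  isomorphic_to_subgroup (free_group r) A ->
  exists gens : 'I_r -> G, generated_by gens A.
Proof.
move=> [f [_ HA]]; exists (fun i => f (elt (i, true))); split.
  by move=> i; apply/HA; exists (elt (i, true)).
move=> P HP Hgens x /HA[y <-].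
have f1 : f 1 = 1 by apply: (@mulgI _ (f 1)); rewrite -gmulfM !mulg1.
elim/free_ind: y => [|[i b] y IH]; first by rewrite f1; apply: subgroup1.
rewrite gmulfM; apply: subgroupM => //; case: b; first exact: Hgens.
have -> : elt (i, false) = (elt (i, true))^-1 :> free_group r by rewrite -elt_inv.
have -> z : f z^-1 = (f z)^-1.
  by apply: (@mulgI _ (f z)); rewrite mulgV -gmulfM mulgV f1.
by apply: subgroupV.
Qed.

Theorem theorem1p6 (k L r : nat) (h : free_group k) (A : free_group k -> Prop) :
  2 <= k -> 2 <= L ->
  cyclically_reduced (word h) ->
  (forall w : seq (letter k), reduced w -> size w = L -> infix w (word h)) ->
  isomorphic_to_subgroup (free_group r) A ->
  (exists T : splitting (free_group k),
     splitting_over T A /\ splitting_relative_to T h) ->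
  (k - 1) * (L - 2) < r.
Proof.
move=> k2 L2 h_cyc h_all /isomorphic_generated[gens Hgens].
move=> [T [[u [v [Huv HAuv]]] [w hw]]].
have HA : subgroup_pred A := edge_stab_subgroup HAuv.
have Hc := edge_colorP Huv HAuv u hw.
have exits := exit_of_color HA Hgens Hc L2 h_cyc h_all.
have [p [g [Hp redp minp]]] := minimal_bichrome exits.
have HL := bichrome_long HA Hc h_cyc h_all Hp redp minp.
pose S := [seq inner p g j | j <- iota 1 (L - 2)].
have mem_S j : j \in iota 1 (L - 2) -> 0 < j < size p.
  rewrite mem_iota => /andP[-> Hj] /=; apply: leq_trans Hj _.
  by rewrite -ltnS; apply: leq_trans HL; rewrite add1n -subSn // subSS subn1 ltn_predL ltnW.
(* For L = 2 the path need not have an interior vertex, and the claim is that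
   [A] is not trivial. *)
have [L0|L0] := posnP (L - 2).
  rewrite L0 muln0 lt0n; apply/eqP => r0.
  have [l [z [Hz Hg]]] := bichrome_loops HA Hc L2 h_cyc h_all Hp redp minp.
  have A1 x : A x -> x = 1.
    apply: (proj2 Hgens (fun x => x = 1)); last first.
      by move=> i; have := ltn_ord i; rewrite [X in _ < X]r0.
    split=> // [y1 y2 -> ->|y ->]; first exact: mulg1.
    exact: invg1.
  have /(congr1 (fun x => word (g^-1 * x * g))) := A1 _ Hg.
  by rewrite !mulgA mulVg mul1g mulgVK mulg1 mulVg word_eval.
have -> : L - 2 = size S by rewrite size_map size_iota.
apply: (full_vertices_le_rank (HA := HA) Hgens).
- exact: ltnW.
- by rewrite size_map size_iota.
- move=> _ /mapP[j /mem_S /andP[j0 jp] ->] l.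
  exact: (inner_loops HA Hc L2 h_cyc h_all Hp minp).
rewrite /S -map_comp map_inj_in_uniq ?iota_uniq //.
move=> i j /mem_S /andP[_ Hi] /mem_S /andP[_ Hj].
by move/(rep_same HA)/(inner_inj HA Hc Hp minp Hi Hj).
Qed.
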